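(* Let $N_1,\dots,N_s\ge2$ ($s\ge1$) be pairwise coprime integers generating the multiplicative monoid $\mathcal S=\{N_1^{\nu_1}\cdots N_s^{\nu_s}:\nu_i\ge0\}$. For a real number $0\le\gamma<s$ let $f\in\mathcal N_\gamma$ be a function which satisfies the functional equations $$f(z^N)^N=\prod_{\zeta^N=1}f(\zeta z)\qquad\text{for all }N\in\mathcal S.$$ If $f$ has a zero in $D$, then $f$ is the zero function.
   Context: $D$ is the open unit disc. For real $\gamma\ge0$, $\mathcal A_\gamma$ is the algebra of analytic functions $f$ on $D$ for which there are constants $a_f,r_f\ge0$ with $|f(z)|\le a_f\exp\big(r_f|\log(1-|z|)|^\gamma\big)$ for all $z\in D$. $\mathcal N_\gamma$ is the algebra of analytic functions on $D$ of the form $f=g_1/g_2$ with $g_1,g_2\in\mathcal A_\gamma$ and $g_2$ without zeroes in $D$. *)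

(* Defs.v *)
From HB Require Import structures.
From mathcomp Require Import all_boot all_order all_algebra.
From mathcomp Require Import all_classical all_reals.
From mathcomp Require Import topology normedtype sequences exp.
From mathcomp Require Import complex.

Set Implicit Arguments.
Unset Strict Implicit.
Unset Printing Implicit Defensive.

Import Order.TTheory GRing.Theory Num.Theory.
Import numFieldNormedType.Exports.

Local Open Scope classical_set_scope.
Local Open Scope complex_scope.
Local Open Scope ring_scope.

(* MathComp-Analysis equips only abstract numFieldTypes and K^o with the
   topology of the norm; this makes the one of R[i]^o canonical on R[i]. *)
HB.instance Definition _ (R : rcfType) := NormedModule.copy R[i] R[i]^o.

(* The norm `|z| of R[i] takes its values in R[i]; [normc z] is the same
   modulus as an element of R. *)
Notation normc := ComplexField.Normc.normc.

Definition unit_disc (R : realType) : set R[i] := [set z | normc z < 1].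

Definition analytic_at (R : realType) (f : R[i] -> R[i]) (z : R[i]) : Prop :=
  exists a : nat -> R[i], \forall w \near z,
    series (fun n => a n * (w - z) ^+ n) @ \oo --> f w.

(* Functions on the disc are total functions on R[i] whose values outside of
   the disc are irrelevant. *)
Definition analytic_on_disc (R : realType) (f : R[i] -> R[i]) : Prop :=
  forall z, unit_disc z -> analytic_at f z.

(* At z = 0 the base of the power is `|ln 1| = 0, and 0 `^ gamma is 0 for
   gamma > 0 and 1 for gamma = 0; in particular A_0 consists of the bounded
   analytic functions. *)
Definition A_gamma (R : realType) (gamma : R) : set (R[i] -> R[i]) :=
  [set f | analytic_on_disc f /\
    exists a r : R, [/\ 0 <= a, 0 <= r &
      forall z, unit_disc z ->
        normc (f z) <= a * expR (r * `|ln (1 - normc z)| `^ gamma)]].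

Definition N_gamma (R : realType) (gamma : R) : set (R[i] -> R[i]) :=
  [set f | analytic_on_disc f /\
    exists g1 g2 : R[i] -> R[i],
      [/\ A_gamma gamma g1, A_gamma gamma g2,
          forall z, unit_disc z -> g2 z != 0 &
          forall z, unit_disc z -> f z = g1 z / g2 z]].

Definition generated_monoid (s : nat) (N : 'I_s -> nat) : set nat :=
  [set n | exists nu : 'I_s -> nat, n = (\prod_(i < s) N i ^ nu i)%N].

(* The product is the finite-support product over the set of all N-th roots of
   unity; for N >= 1 this set is finite. *)
Definition functional_equation (R : realType) (f : R[i] -> R[i]) (N : nat) :
    Prop :=
  forall z, unit_disc z ->
    f (z ^+ N) ^+ N =
      \big[*%R/1]_(zeta \in [set zeta : R[i] | zeta ^+ N = 1]) f (zeta * z).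

(* Main.v *)
Require Import Defs.
From mathcomp Require Import all_boot all_order all_algebra.
From mathcomp Require Import all_classical all_reals.
From mathcomp Require Import topology normedtype sequences exp.
From mathcomp Require Import complex.

Set Implicit Arguments.
Unset Strict Implicit.
Unset Printing Implicit Defensive.

Import Order.TTheory GRing.Theory Num.Theory.
Import numFieldNormedType.Exports.

Local Open Scope classical_set_scope.
Local Open Scope complex_scope.
Local Open Scope ring_scope.

(** The term zeta = 1 of the functional equation shows that f(w) = 0 implies
    f(w^N) = 0, so f vanishes at all the points w^(N^k), which tend to 0.  On
    the other hand, if f does not vanish near 0 and has order m there, the two
    sides of the functional equation have orders N^2 m and N m, so m = 0 and f
    has no zero near 0.  Hence f vanishes near 0, and on the whole disc by the
    identity theorem. *)

(** * Local behaviour of a power series at its centre *)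

Lemma geometric_sum_le2 (K : numFieldType) (x : K) (n : nat) :
  0 <= x -> x <= 2^-1 -> \sum_(k < n) x ^+ k <= 2.
Proof.
move=> x0 x2; set S := \sum_(_ < _) _.
have S0 : 0 <= S by apply: sumr_ge0 => k _; rewrite exprn_ge0.
have h : 2^-1 <= 1 - x.
  rewrite lerBrDr (le_trans (lerD (lexx _) x2))//.
  by rewrite -mulr2n -[_ ^-1 *+ _]mulr_natr mulVf ?pnatr_eq0.
have : 2^-1 * S <= 1.
  apply: le_trans (_ : (1 - x) * S <= 1); first exact: ler_wpM2r.
  by rewrite -opprB mulNr -subrX1 opprB lerBlDr lerDl exprn_ge0.
by rewrite mulrC ler_pdivrMr// mul1r.
Qed.

Lemma near_norm_lt (K : numFieldType) (z e : K) : 0 < e ->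
  \forall w \near z, `|w - z| < e.
Proof.
move=> e0; apply/nbhs_normP; exists e => // w /=.
by rewrite distrC.
Qed.

(** Each term after the [m]-th is at most [M * (|u| / r) ^ k], and the ratio [|u| / r] is at most
    1/2, so the tail is at most twice its first majorant. *)
Lemma power_series_tail_le (K : numFieldType) (a : nat -> K) (r M u l : K)
    (m : nat) :
    0 < r -> (forall n, `|a n| * r ^+ n <= M) -> `|u| <= r / 2 ->
    (forall k, (k < m)%N -> a k = 0) ->
    series (fun n => a n * u ^+ n) @ \oo --> l ->
  `|l - a m * u ^+ m| <= 2 * M / r ^+ m.+1 * `|u| ^+ m.+1.
Proof.
move=> r0 aM ur a0 /cvgrPdist_lt sl.
have M0 : 0 <= M by rewrite (le_trans _ (aM 0%N))// mulr_ge0// exprn_ge0// ltW.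
have x2 : `|u| / r <= 2^-1 by rewrite ler_pdivrMr// mulrC.
have x0 : 0 <= `|u| / r by rewrite divr_ge0// ltW.
have partial n : `|series (fun n => a n * u ^+ n) (m.+1 + n)%N - a m * u ^+ m|
    <= 2 * M / r ^+ m.+1 * `|u| ^+ m.+1.
  rewrite /series/= (big_cat_nat (leq0n m.+1) (leq_addr n m.+1))/=.
  rewrite big_nat_recr//= big_nat big1 ?add0r; last first.
    by move=> k /andP[_ km]; rewrite a0// mul0r.
  rewrite addrAC subrr add0r -{1}[m.+1]add0n (addnC m.+1 n) big_addn addnK.
  rewrite big_mkord (le_trans (ler_norm_sum _ _ _))//.
  have step (k : 'I_n) : `|a (k + m.+1)%N * u ^+ (k + m.+1)| <=
      M * (`|u| / r) ^+ m.+1 * (`|u| / r) ^+ k.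
    rewrite normrM normrX -mulrA -exprD (addnC k) expr_div_n mulrA.
    by rewrite ler_pdivlMr ?exprn_gt0// mulrAC ler_wpM2r ?exprn_ge0.
  rewrite (le_trans (ler_sum _ (fun k _ => step k)))// -mulr_sumr.
  rewrite expr_div_n [leRHS](_ : _ = M * (`|u| ^+ m.+1 / r ^+ m.+1) * 2).
    rewrite ler_wpM2l ?geometric_sum_le2// mulr_ge0// divr_ge0 ?exprn_ge0//.
    exact: ltW.
  by rewrite -[_ * 2]mulrC mulrA [_ / _ * _]mulrAC mulrA.
(* The bound is uniform in [n], so it passes to the limit: one partial sum within [e] of [l] is
   enough. *)
apply/ler_addgt0Pr => e e0.
have [n0 _ hn0] := sl _ e0.
have le := hn0 (m.+1 + n0)%N (leq_addl _ _).
rewrite -(subrK (series (fun n => a n * u ^+ n) (m.+1 + n0)%N) l) -addrA.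
by rewrite (le_trans (ler_normD _ _))// [leRHS]addrC lerD// ltW.
Qed.

(** Close to the centre the first nonzero term dominates the rest. The order is recorded by
    two-sided bounds on the modulus because these can be multiplied and raised to powers without
    handling coefficients. *)
Lemma power_series_order (K : numFieldType) (a : nat -> K) (f : K -> K)
    (z : K) :
    (\forall w \near z, series (fun n => a n * (w - z) ^+ n) @ \oo --> f w) ->
  (\forall w \near z, f w = 0) \/
  exists m c C, [/\ 0 < c, 0 < C &
    \forall w \near z, c * `|w - z| ^+ m <= `|f w| <= C * `|w - z| ^+ m].
Proof.
move=> af; have [ex_a|] := pselect (exists n, a n != 0); last first.
  move=> /forallNP a0; left; apply: filterS af => w.
  have -> : series (fun n => a n * (w - z) ^+ n) = (fun=> 0).
    apply/funext => n; rewrite /series/= big1// => k _.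
    by have /negP/negPn/eqP -> := a0 k; rewrite mul0r.
  move=> fw; apply/esym.
  by apply: cvg_unique fw; [exact: norm_hausdorff|exact: cvg_cst].
right; set m := ex_minn ex_a; exists m.
have [am0 min_m] : a m != 0 /\ forall k, (k < m)%N -> a k = 0.
  rewrite /m; case: ex_minnP => k ak mink; split=> // j jk.
  by apply/eqP; apply: contraTT jk => /mink; rewrite -leqNgt.
have [e /= e0 he] := (iffLR (nbhs_normP _ _)) af.
have r0 : 0 < e / 2 by rewrite divr_gt0.
(* The series converges at the point [z + e / 2], so its terms there are bounded. *)
have [M M0 aM] : exists2 M, 0 < M & forall n, `|a n| * (e / 2) ^+ n <= M.
  have /cvgP/cvg_series_cvg_0/cvgP/cvg_seq_bounded :
      series (fun n => a n * (e / 2) ^+ n) @ \oo --> f (z + e / 2).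
    have := he (z + e / 2); rewrite addrAC subrr add0r; apply.
    rewrite /= opprD addrA subrr sub0r normrN gtr0_norm//.
    by rewrite ltr_pdivrMr// mulr_natr mulr2n ltrDl.
  move=> /pinfty_ex_gt0 [M M0 hM]; exists M => // n.
  by have := hM n Logic.I; rewrite /= normrM normrX (gtr0_norm r0).
set B := 2 * M / (e / 2) ^+ m.+1.
have B0 : 0 < B by rewrite divr_gt0 ?mulr_gt0 ?exprn_gt0.
have na0 : 0 < `|a m| by rewrite normr_gt0.
(* Near [z] the tail will be at most half the leading term, so [f w] lies between 1/2 and 3/2 of
   that term in modulus; 3/2 is rounded up to 2. *)
exists (`|a m| / 2), (`|a m| * 2).
split; [by rewrite divr_gt0|by rewrite mulr_gt0|].
have wr : \forall w \near z, `|w - z| < e / 2 / 2.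
  by apply: near_norm_lt; rewrite divr_gt0.
have wB : \forall w \near z, `|w - z| < `|a m| / 2 / B.
  by apply: near_norm_lt; rewrite divr_gt0// divr_gt0.
apply: filterS3 af wr wB => w sw wr wB.
have := power_series_tail_le r0 aM (ltW wr) min_m sw.
rewrite -/B exprS mulrA => tail.
have {}tail : `|f w - a m * (w - z) ^+ m| <= `|a m| / 2 * `|w - z| ^+ m.
  rewrite (le_trans tail)// ler_wpM2r ?exprn_ge0// mulrC.
  rewrite -ler_pdivlMr//; exact: ltW.
have nm : `|a m * (w - z) ^+ m| = `|a m| * `|w - z| ^+ m.
  by rewrite normrM normrX.
apply/andP; split.
  have := lerB_dist (a m * (w - z) ^+ m) (f w).
  rewrite distrC => /le_trans/(_ tail); rewrite nm lerBlDr -lerBlDl.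
  by rewrite -mulrBl {1}(splitr `|a m|) addrK.
have := lerB_dist (f w) (a m * (w - z) ^+ m).
move=> /le_trans/(_ tail); rewrite nm lerBlDr -mulrDl => /le_trans; apply.
rewrite ler_wpM2r ?exprn_ge0// mulr_natr [leRHS]mulr2n lerD2r.
by rewrite ler_pdivrMr// ler_peMr// ler1n.
Qed.

(** Positive elements of [R[i]] are real, so the radius and both constants descend from [R[i]] to
    [R]. *)
Lemma analytic_order (R : realType) (f : R[i] -> R[i]) (z : R[i]) :
    analytic_at f z -> exists2 d : R, 0 < d &
  (forall w, normc (w - z) < d -> f w = 0) \/
  exists m c C, [/\ 0 < c, 0 < C & forall w, normc (w - z) < d ->
    c * normc (w - z) ^+ m <= normc (f w) <= C * normc (w - z) ^+ m].
Proof.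
have posE (e : R[i]) : 0 < e -> exists2 r : R, 0 < r & e = r%:C.
  by case: e => r j; rewrite ltcE /= => /andP[/eqP -> r0]; exists r.
have near_disc (P : R[i] -> Prop) : (\forall w \near z, P w) ->
    exists2 d : R, 0 < d & forall w, normc (w - z) < d -> P w.
  move=> /nbhs_normP[_/= /posE[d d0 ->] dP]; exists d => // w wd.
  by apply: dP; rewrite /= distrC ltcR.
move=> [a /power_series_order[/near_disc[d d0 fd]|]].
  by exists d => //; left.
move=> [m [_ [_ [/posE[c c0 ->] /posE[C C0 ->] /near_disc[d d0 fd]]]]].
exists d => //; right; exists m, c, C; split=> // w /fd.
have normE (x : R[i]) : `|x| = (normc x)%:C by [].
by rewrite !normE -!rmorphXn -!rmorphM !lecR.
Qed.

(** * Identity theorem on the disc *)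

(** A connectedness argument on the segment from 0 to [b]: take the supremum [T] of the parameters
    up to which [f] vanishes, and look at the order of [f] at [T * b]. *)
Lemma analytic_identity (R : realType) (f : R[i] -> R[i]) (e : R) :
    analytic_on_disc f -> 0 < e -> (forall w, normc w < e -> f w = 0) ->
  forall z, unit_disc z -> f z = 0.
Proof.
move=> f_an e0 f0 b b1.
have nX (t : R) : 0 <= t -> normc (t%:C * b) = t * normc b.
  move=> t0; rewrite ComplexField.Normc.normcM; congr (_ * _).
  by rewrite /= expr0n addr0 sqrtr_sqr ger0_norm.
have nB (t u : R) : u <= t -> normc (u%:C * b - t%:C * b) = (t - u) * normc b.
  move=> ut; rewrite -nX ?subr_ge0// -mulrBl -rmorphB -opprB rmorphN mulNr.
  by rewrite normcN.
have b0 : 0 <= normc b by case: (b) => *; exact: sqrtr_ge0.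
have [/ComplexField.Normc.eq0_normc ->|bN0] := eqVneq (normc b) 0.
  by apply: f0; rewrite ComplexField.Normc.normc0.
have {bN0}b0' : 0 < normc b by rewrite lt_def bN0.
have lt_mulb (t d : R) : 0 <= t -> t < d -> t * normc b < d.
  by move=> t0; apply: le_lt_trans; rewrite ler_piMr// ltW.
pose E := [set t : R | 0 <= t <= 1 /\
  forall u, 0 <= u <= t -> f (u%:C * b) = 0].
have Et0 : E (Num.min 1 (e / 2)).
  split; first by rewrite le_min ler01 ge_min lexx divr_ge0// ltW.
  move=> u /andP[u0 ut]; apply: f0; rewrite nX// lt_mulb//.
  rewrite (le_lt_trans ut)// gt_min; apply/orP; right.
  by rewrite ltr_pdivrMr// ltr_pMr// ltr1n.
have supE : has_sup E.
  by split; [exists (Num.min 1 (e / 2))|exists 1 => t [/andP[]]].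
set T := sup E.
have ub (t : R) : E t -> t <= T by exact: sup_upper_bound.
have T0 : 0 < T.
  by rewrite (lt_le_trans _ (ub _ Et0))// lt_min ltr01 divr_gt0.
have T1 : T <= 1 by apply: sup_le_ub; [exact: supE.1|move=> t [/andP[]]].
have below (u : R) : 0 <= u -> u < T -> f (u%:C * b) = 0.
  move=> u0 uT.
  have Tu : 0 < T - u by rewrite subr_gt0.
  have [t [_ ht]] := sup_adherent Tu supE.
  by rewrite opprB addrCA subrr addr0 => /ltW ut; apply: ht; rewrite u0.
have TD : unit_disc (T%:C * b).
  by rewrite /unit_disc/= nX ?(ltW T0)// (le_lt_trans _ b1)// ler_piMl.
have [d d0 [fd|[m [c [C [c0 _ fd]]]]]] := analytic_order (f_an _ TD).
  (* If [f] vanishes around [T * b], vanishing extends past [T], which is impossible unless 1 has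
     been reached; then [f b = 0]. *)
  have Eu : E (Num.min 1 (T + d / 2)).
    split; first by rewrite le_min ler01 ge_min lexx addr_ge0 ?divr_ge0// ltW.
    move=> u /andP[u0]; rewrite le_min => /andP[u1 uT].
    have [|Tu] := ltP u T; first exact: below.
    apply: fd; rewrite -normcN opprB nB// lt_mulb ?subr_ge0//.
    rewrite ltrBlDl (le_lt_trans uT)// ltrD2l.
    by rewrite ltr_pdivrMr// ltr_pMr// ltr1n.
  have := ub _ Eu; rewrite ge_min => /orP[T1'|].
    have m1 : Num.min 1 (T + d / 2) = 1.
      by apply/min_idPl; rewrite (le_trans T1')// lerDl divr_ge0// ltW.
    have := Eu.2 1; rewrite m1 mul1r; apply.
    by rewrite ler01 lexx.
  by rewrite gerDl leNgt divr_gt0.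
(* Otherwise the lower bound forbids zeros near [T * b] other than the centre, but [u * b] with [u]
   slightly below [T] is one. *)
have [u [u0 uT Tud]] : exists u : R, [/\ 0 <= u, u < T & T - u < d].
  exists (Num.max 0 (T - d / 2)); split.
  - by rewrite le_max lexx.
  - by rewrite gt_max T0 gtrBl divr_gt0.
  - rewrite ltrBlDl -ltrBlDr lt_max ltrD2l ltrN2; apply/orP; right.
    by rewrite ltr_pdivrMr// ltr_pMr// ltr1n.
have /fd : normc (u%:C * b - T%:C * b) < d.
  by rewrite nB ?ltW// lt_mulb// subr_ge0 ltW.
rewrite below// ComplexField.Normc.normc0 nB ?(ltW uT)// => /andP[+ _].
by rewrite leNgt mulr_gt0// exprn_gt0// mulr_gt0// subr_gt0.
Qed.

(** * Roots of unity and the functional equation near 0 *)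

(** More than [n] roots would exceed the degree of [X^n - 1]. Finiteness allows the finite-support
    product to be expanded over the actual roots. *)
Lemma finite_unity_roots (F : fieldType) (n : nat) : (0 < n)%N ->
  finite_set [set x : F | x ^+ n = 1].
Proof.
move=> n0; apply: contrapT => /(infinite_set_fset n.+1)[B B1].
apply/negP; rewrite -leqNgt; apply: max_unity_roots => //;
  last exact: finmap.fset_uniq.
by apply/allP => x /B1 /=; rewrite unity_rootE => ->.
Qed.

Lemma generated_monoid_gen (s : nat) (N : 'I_s -> nat) (i : 'I_s) :
  generated_monoid N (N i).
Proof.
exists (fun j => (j == i) : nat).
rewrite (bigD1 i)//= eqxx expn1 big1 ?muln1// => j /negPf ->.
by rewrite expn0.
Qed.

Lemma normc_ge0 (R : rcfType) (x : R[i]) : 0 <= normc x.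
Proof. by case: x => *; exact: sqrtr_ge0. Qed.

Lemma normcX (R : rcfType) (x : R[i]) (n : nat) :
  normc (x ^+ n) = normc x ^+ n.
Proof.
elim: n => [|n IHn]; first exact: ComplexField.Normc.normc1.
by rewrite !exprS ComplexField.Normc.normcM IHn.
Qed.

Lemma normc_real (R : rcfType) (x : R) : 0 <= x -> normc x%:C = x.
Proof. by move=> x0; rewrite /= expr0n addr0 sqrtr_sqr ger0_norm. Qed.

Lemma functional_equation_zero (R : realType) (f : R[i] -> R[i]) (n : nat) :
    (0 < n)%N -> functional_equation f n ->
  forall z, unit_disc z -> f z = 0 -> f (z ^+ n) = 0.
Proof.
move=> n0 feq z zD fz; apply/eqP.
suff : f (z ^+ n) ^+ n == 0 by rewrite expf_eq0 n0.
have fin := @finite_unity_roots R[i] _ n0.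
by rewrite feq// (fsbigD1 1)//= ?expr1n// mul1r fz mul0r.
Qed.

Lemma functional_equation_order0 (R : realType) (f : R[i] -> R[i]) (n m : nat)
    (d c C : R) :
    (1 < n)%N -> functional_equation f n -> 0 < d -> 0 < c -> 0 < C ->
    (forall w, normc w < d ->
      c * normc w ^+ m <= normc (f w) <= C * normc w ^+ m) ->
  m = 0%N.
Proof.
move=> n1 feq d0 c0 C0 fd; have n0 := ltnW n1.
case: m fd => // m fd; exfalso.
(* At a small real x the equation gives (q x^(m+1))^n <= (C x^(n(m+1)))^n; that
   there are at most n roots of unity suffices, since q x^(m+1) <= 1. *)
pose q := Num.min c 1; pose x := Num.min d (Num.min 1 (q / C)) / 2.
have q0 : 0 < q by rewrite lt_min c0 ltr01.
have y0 : 0 < Num.min d (Num.min 1 (q / C)).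
  by rewrite !lt_min d0 ltr01 divr_gt0.
have x0 : 0 < x by rewrite divr_gt0.
have : x < Num.min d (Num.min 1 (q / C)).
  by rewrite /x ltr_pdivrMr// ltr_pMr// ltr1n.
rewrite !lt_min => /and3P[xd x1 xq].
have x0' := ltW x0; have x1' := ltW x1.
have xD : unit_disc x%:C.
  by rewrite -[_ x%:C]/(is_true (normc x%:C < 1)) normc_real.
have feqx := congr1 (@ComplexField.Normc.normc R) (feq _ xD).
have upper : normc (f (x%:C ^+ n) ^+ n) <= (C * (x ^+ n) ^+ m.+1) ^+ n.
  have /fd/andP[_] : normc (x%:C ^+ n) < d.
    by rewrite normcX normc_real// (le_lt_trans _ xd)// ler_iXnr.
  rewrite !normcX normc_real// => le; rewrite lerXn2r// nnegrE ?normc_ge0//.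
  by rewrite mulr_ge0 ?exprn_ge0// ltW.
have lower : (q * x ^+ m.+1) ^+ n <= normc (f (x%:C ^+ n) ^+ n).
  have fin := @finite_unity_roots R[i] _ n0.
  have q1 : q * x ^+ m.+1 <= 1.
    by rewrite mulr_ile1 ?exprn_ile1 ?exprn_ge0 ?(ltW q0)// ge_min lexx orbT.
  have q2 : 0 <= q * x ^+ m.+1 by rewrite mulr_ge0 ?exprn_ge0 ?(ltW q0).
  rewrite feqx fsbig_finite//=.
  rewrite (big_morph _ (@ComplexField.Normc.normcM R)
    (@ComplexField.Normc.normc1 R)).
  set rs := finmap.enum_fset _.
  have rsP z : z \in rs -> z ^+ n = 1.
    by rewrite /rs in_fset_set// => /set_mem.
  have szrs : (size rs <= n)%N.
    apply: max_unity_roots => //; last exact: finmap.fset_uniq.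
    by apply/allP => z /rsP zn; rewrite unity_rootE zn.
  apply: le_trans (ler_wiXn2l q2 q1 szrs) _.
  rewrite -iter_mulr_1 -count_predT -(big_const_seq 1 *%R) big_seq [leRHS]big_seq.
  apply: ler_prod => z /rsP zn.
  rewrite q2/=.
  (* Roots of unity have modulus 1, so the lower bound at radius [x] serves every factor. *)
  have nz : normc (z * x%:C) = x.
    rewrite ComplexField.Normc.normcM normc_real//.
    have /eqP := congr1 (@ComplexField.Normc.normc R) zn.
    rewrite normcX ComplexField.Normc.normc1 pexpr_eq1 ?normc_ge0//.
    by move=> /eqP ->; rewrite mul1r.
  have := fd (z * x%:C); rewrite nz => /(_ xd) /andP[+ _]; apply: le_trans.
  by rewrite ler_wpM2r ?exprn_ge0// ge_min lexx.
have := le_trans lower upper.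
rewrite ler_pXn2r ?nnegrE ?mulr_ge0 ?exprn_ge0 ?(ltW q0) ?(ltW C0)//.
(* As [n >= 2], the exponent [n * m.+1] is at least [m.+2]. Cancelling [x ^+ m.+1] leaves
   [q <= C * x], against the choice [x < q / C]. *)
have xn : (x ^+ n) ^+ m.+1 <= x * x ^+ m.+1.
  rewrite -exprM -exprS ler_wiXn2l// (leq_trans (_ : _ <= 2 * m.+1)%N)//.
    by rewrite mul2n -addnn addSn ltnS leq_addl.
  by rewrite leq_mul2r n1 orbT.
move=> /le_trans /(_ (ler_wpM2l (ltW C0) xn)).
rewrite mulrA ler_pM2r ?exprn_gt0// leNgt => /negP; apply.
by rewrite mulrC -ltr_pdivlMr.
Qed.

(** Since [k < n ^ k], the modulus is at most the [k]-th power of [normc w], which tends to 0. *)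
Lemma unit_disc_iter_small (R : realType) (w : R[i]) (n : nat) (d : R) :
  (1 < n)%N -> unit_disc w -> 0 < d -> exists k, normc (w ^+ (n ^ k)) < d.
Proof.
move=> n1 wD d0.
have w0 := normc_ge0 w.
have : (GRing.exp (normc w) @ \oo --> (0 : R))%classic.
  by apply: cvg_expr; rewrite ger0_norm.
move=> /cvgrPdist_lt /(_ _ d0) [k _ /(_ k (leqnn k))] /=.
rewrite sub0r normrN ger0_norm ?exprn_ge0// => wk; exists k.
rewrite normcX (le_lt_trans _ wk)// ler_wiXn2l// ?(ltW wD)//.
by rewrite ltnW// ltn_expl.
Qed.

Theorem theorem55 (R : realType) (s : nat) (N : 'I_s -> nat)
    (s_ge1 : (1 <= s)%N)
    (N_ge2 : forall i, (2 <= N i)%N)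
    (N_coprime : forall i j, i != j -> coprime (N i) (N j))
    (gamma : R) (gamma_ge0 : 0 <= gamma) (gamma_lts : gamma < s%:R)
    (f : R[i] -> R[i]) (fN : N_gamma gamma f)
    (f_eq : forall n, generated_monoid N n -> functional_equation f n) :
  (exists2 z, unit_disc z & f z = 0) -> forall z, unit_disc z -> f z = 0.
Proof.
move=> [w wD fw]; have [f_an _] := fN.
pose n := N (Ordinal s_ge1).
have n1 : (1 < n)%N by exact: N_ge2.
have n0 := ltnW n1.
have feq : functional_equation f n by exact/f_eq/generated_monoid_gen.
have D0 : unit_disc (0 : R[i]).
  by rewrite -[_ 0]/(is_true (normc 0 < 1)) ComplexField.Normc.normc0 ltr01.
have [d d0 [f0|]] := analytic_order (f_an _ D0).
  by apply: (analytic_identity f_an d0) => z zd; apply: f0; rewrite subr0.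
move=> [m [c [C [c0 C0 fd]]]].
have {}fd z : normc z < d ->
    c * normc z ^+ m <= normc (f z) <= C * normc z ^+ m.
  by move=> zd; have := fd z; rewrite subr0; apply.
(* With [m = 0] the lower bound becomes the constant [c > 0] on the disc of radius [d], which some
   zero [w ^+ (n ^ k)] enters. *)
have m0 := functional_equation_order0 n1 feq d0 c0 C0 fd.
have iter k : unit_disc (w ^+ (n ^ k)) /\ f (w ^+ (n ^ k)) = 0.
  elim: k => [|k [kD fk]]; first by rewrite expn0 expr1.
  rewrite expnSr exprM; split; last exact: functional_equation_zero.
  by rewrite /unit_disc /= normcX exprn_ilt1// ?normc_ge0// -lt0n.
have [k /fd] := unit_disc_iter_small n1 wD d0.
rewrite (iter k).2 m0 expr0 mulr1 ComplexField.Normc.normc0 => /andP[+ _].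
by rewrite leNgt c0.
Qed.
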